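(* Let $A$ be an essential domain and let $B$ be a lying over overring of $A$. Then $A=B$.
   Context: All rings are commutative unitary integral domains. An overring of a domain $A$ is a ring $B$ between $A$ and the quotient field of $A$. A prime ideal $P$ of $A$ is called a valued prime if the localization $A_P$ is a valuation domain (fields count as valuation domains). $A$ is an essential domain if $A=\bigcap_{P\in G}A_P$, where $G$ is the set of valued primes of $A$. An overring $B$ of $A$ is a lying over overring if the contraction map $\mathrm{Spec}(B)\to\mathrm{Spec}(A)$, $Q\mapsto Q\cap A$, is surjective. *)

(* Defs.v *)
From HB Require Import structures.
From mathcomp Require Import all_boot all_order all_algebra.
From mathcomp Require Import ring_quotient.
From mathcomp Require Import all_classical.

Set Implicit Arguments.
Unset Strict Implicit.
Unset Printing Implicit Defensive.

Import GRing.Theory.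
Local Open Scope ring_scope.
Local Open Scope classical_set_scope.

(* Rings are idomainTypes (nontrivial commutative domains), and
   the quotient field of A is {fraction A}. Prime ideals are the library's
   [prime_idealr R], i.e. boolean predicates; overrings are boolean predicates
   too. Classically, every subset of a type is given by such a predicate. *)

Notation "x %:F" := (@FracField.tofrac _ x) : ring_scope.

Definition frac_image (A : idomainType) : set {fraction A} :=
  range (fun a : A => a%:F).
Arguments frac_image A : clear implicits.

Definition localization (A : idomainType) (P : prime_idealr A) :
    set {fraction A} :=
  [set x | exists a s : A, s \notin (P : {pred A}) /\ x = a%:F / s%:F].

(* V is a valuation ring of K. For V a subring of K this says that V is a
   valuation domain with quotient field K; a localization of A inside
   {fraction A} contains A, so its quotient field is {fraction A}. *)
Definition valuation_subring (K : fieldType) (V : set K) : Prop :=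
  forall x : K, x != 0 -> V x \/ V x^-1.

Definition valued_primes (A : idomainType) : set (prime_idealr A) :=
  [set P | valuation_subring (localization P)].
Arguments valued_primes A : clear implicits.

Definition essential_domain (A : idomainType) : Prop :=
  frac_image A = \bigcap_(P in valued_primes A) localization P.

Record overring (A : idomainType) := Overring {
  overring_pred : pred {fraction A};
  overring_subring : subring_closed overring_pred;
  overring_frac : forall a : A, overring_pred a%:F
}.

Section OverringType.
Variables (A : idomainType) (B : overring A).

HB.instance Definition _ := GRing.isSubringClosed.Build
  {fraction A} (overring_pred B) (overring_subring B).

(* The overring as a ring in its own right, so that its prime ideals are the
   elements of [prime_idealr (overring_type B)]. *)
Definition overring_type : Type := {x : {fraction A} | overring_pred B x}.

HB.instance Definition _ := SubChoice.on overring_type.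
HB.instance Definition _ := [SubChoice_isSubComNzRing of overring_type by <:].

Definition overring_inj (a : A) : overring_type :=
  exist _ a%:F (overring_frac B a).

Definition overring_set : set {fraction A} := [set x | overring_pred B x].

End OverringType.

Section Contraction.
Variables (A : idomainType) (B : overring A).
Variable Q : prime_idealr (overring_type B).

Definition contraction_pred : pred A :=
  fun a => overring_inj B a \in (Q : {pred overring_type B}).

Lemma overring_inj_zmod_morphism : zmod_morphism (overring_inj B).
Proof. by move=> a b; apply: val_inj; rewrite /= rmorphB. Qed.

Lemma overring_inj_monoid_morphism : monoid_morphism (overring_inj B).
Proof.
by split=> [|a b]; apply: val_inj; rewrite /= ?rmorph1 ?rmorphM.
Qed.

Lemma mem_contraction_pred a :
  (a \in contraction_pred) = (overring_inj B a \in (Q : {pred overring_type B})).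
Proof. by []. Qed.

Lemma contraction_idealr_closed : idealr_closed contraction_pred.
Proof.
have inj0 : overring_inj B 0 = 0 by apply: val_inj; rewrite /= rmorph0.
have injB := overring_inj_zmod_morphism.
have [inj1 injM] := overring_inj_monoid_morphism.
split=> [||a u v]; rewrite !mem_contraction_pred.
- by rewrite inj0 idealr0.
- by rewrite inj1 idealr1.
- move=> Qu Qv.
  have -> : a * u + v = a * u - (0 - v) by rewrite sub0r opprK.
  by rewrite !injB injM inj0 rpredB ?rpredB ?idealMr ?idealr0.
Qed.

Lemma contraction_prime_idealr_closed : prime_idealr_closed contraction_pred.
Proof.
have [_ injM] := overring_inj_monoid_morphism.
by move=> u v; rewrite !mem_contraction_pred injM prime_idealrM.
Qed.

HB.instance Definition _ :=
  isIdealr.Build A contraction_pred contraction_idealr_closed.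
HB.instance Definition _ := isPrimeIdealrClosed.Build
  A contraction_pred contraction_prime_idealr_closed.

(* Q :&: A, for A identified with its image in B. *)
Definition contraction : prime_idealr A := contraction_pred.

End Contraction.

(* Surjectivity of the contraction map on spectra; prime ideals are compared
   extensionally. *)
Definition lying_over (A : idomainType) (B : overring A) : Prop :=
  forall P : prime_idealr A,
    exists Q : prime_idealr (overring_type B),
      (contraction Q : {pred A}) =i (P : {pred A}).

(* Main.v *)
(* For x in B and a valued prime P, if x is not in A_P then 1/x = a/s with
   s outside P and a in P. A prime Q of B over P contains a, hence also
   s = x a, contradicting s outside P. So B lies in every A_P. *)
Require Import Defs.
From mathcomp Require Import all_boot all_order all_algebra.
From mathcomp Require Import ring_quotient.
From mathcomp Require Import all_classical.

Import GRing.Theory.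
Local Open Scope ring_scope.
Local Open Scope classical_set_scope.

Lemma overring_sub_valued_localization (A : idomainType) (B : overring A)
    (P : prime_idealr A) (Q : prime_idealr (overring_type B)) :
  (contraction Q : {pred A}) =i (P : {pred A}) -> valued_primes A P ->
  overring_set B `<=` localization P.
Proof.
move=> QP valP x Bx.
have [->|x0] := eqVneq x 0.
  by exists 0, 1; rewrite idealr1 rmorph0 mul0r.
case: (valP x x0) => [//|[a [s [Ps xV]]]].
have xE : x = s%:F / a%:F by rewrite -[x]invrK xV invf_div.
(* If [a] is outside [P], then [s / a] already exhibits [x] in the localization. *)
have [Pa|Pa] := boolP (a \in (P : {pred A})); last by exists s, a.
have a0 : a%:F != 0 :> {fraction A}.
  (* Since the inverse of 0 is 0 by convention, [a = 0] would force [x = 0]. *)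
  by apply: contraNneq x0 => a0; rewrite xE a0 invr0 mulr0.
case/negP: Ps; move: Pa; rewrite -!QP => Qa.
pose xB : overring_type B := exist _ x Bx.
have sE : overring_inj B s = xB * overring_inj B a.
  by apply: val_inj; rewrite /= xE divfK.
(* By conversion, this is membership of [s] in [contraction Q]. *)
have : overring_inj B s \in (Q : {pred overring_type B}).
  by rewrite sE; exact: (@idealMr _ Q xB (overring_inj B a) Qa).
by [].
Qed.

Theorem theorem1 (A : idomainType) (B : overring A) :
  essential_domain A -> lying_over B -> frac_image A = overring_set B.
Proof.
move=> essA lyB; apply/seteqP; split=> [_ [a _ <-]|x Bx].
  exact: overring_frac.
(* Essentiality reduces the claim to one valued prime at a time. *)
rewrite essA => P valP; have [Q QP] := lyB P.
exact: overring_sub_valued_localization QP valP x Bx.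
Qed.
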